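(* For every $n$, the space $|K^{1}(n)|$ is a strong deformation retract of $|K^{ht}(n)|$.
   Context: **Trees.** A planar planted tree is a finite tree with a cyclic order on the flags (half-edges) at each vertex and a distinguished flag, whose vertex is the root. Leaves are the valence-1 vertices other than the root; edges are oriented to the root; $|v|$ is the number of incoming edges at $v$. A b/w tree has vertices coloured black/white with black root and white leaves. An edge is black, white or mixed according to the colours of its ends. A b/w tree is bipartite if all edges are mixed. It is stably bipartite if (1) there are no white edges; (2) no black vertex of arity 1 and valence 2 has both edges black; (3) no black vertex of arity 1 and valence 2 has one black edge and one edge to a leaf; (4) the root has valence 1 only if its edge is mixed. An effective white angle is a pair of distinct flags $(f_1,f_2)$ at a white vertex with $f_2$ the immediate successor of $f_1$; collapsing it means identifying the two edges of the angle and their other end points. $\mathcal T_{bipart}(n)$: bipartite b/w trees with white vertices labelled bijectively by $\{1,\dots,n\}$. $\mathcal T_{ht}(n)$: pairs $(\tau,h)$, $\tau$ a so labelled stably bipartite tree, $h:E_{black}(\tau)\to\{v,1\}$; $E_v$ is the set of black edges labelled $v$. **Differentials.** On $\mathbb Z\mathcal T_{bipart}(n)$: $\partial\tau$ is the sum over all effective white angles of $\pm$ the tree with that angle collapsed. On $\mathbb Z\mathcal T_{ht}(n)$: the same sum (heights unchanged) plus $\sum_{e\in E_v}\pm[(\tau/e,h|)-(\tau,h')]$, where $\tau/e$ is $\tau$ with $e$ contracted and $h'$ changes the label of $e$ to $1$. **Complexes.** $K^1(n)$ is the CW complex with one cell $C(\tau)=\prod_{v\,white}\Delta^{|v|}$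 for each $\tau\in\mathcal T_{bipart}(n)$. $K^{ht}(n)$ is the CW complex with one cell $C(\tau,h)=\prod_{v\,white}\Delta^{|v|}\times I^{E_v}$ for each $(\tau,h)\in\mathcal T_{ht}(n)$. Attaching maps are given by $\partial C(\tau)=C(\partial\tau)$. $|K^1(n)|$ is regarded as a subspace of $|K^{ht}(n)|$ because bipartite trees are stably bipartite trees without black edges. *)

(* Defs.v *)
From Stdlib Require Import Relation_Operators.
From HB Require Import structures.
From mathcomp Require Import all_boot all_order all_algebra.
From mathcomp Require Import generic_quotient.
From mathcomp Require Import all_classical all_reals all_analysis.

Set Implicit Arguments.
Unset Strict Implicit.
Unset Printing Implicit Defensive.

Import Order.TTheory GRing.Theory Num.Theory.
Import numFieldNormedType.Exports.

Local Open Scope classical_set_scope.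
Local Open Scope ring_scope.

(** * Planar planted trees with black and white vertices *)

(* A planar planted tree is a rooted tree in which the children of every vertex
   are linearly ordered: at a vertex other than the root, the cyclic order of
   the flags is cut at the outgoing flag; at the root, it is cut just before the
   distinguished flag.  [Node None ts] is a black vertex with children [ts];
   [Node (Some i) ts] is a white vertex with label [i].  The arity |v| of a
   vertex is its number of children.  Black vertices carry no label. *)
Inductive bwtree (n : nat) : Type :=
  Node of option 'I_n & seq (bwtree n).

HB.instance Definition _ n := gen_eqMixin (bwtree n).
HB.instance Definition _ n := gen_choiceMixin (bwtree n).

Section Trees.
Variable n : nat.
Implicit Types (t s : bwtree n) (ts : seq (bwtree n)) (i : 'I_n).

Definition colour t := let: Node c _ := t in c.
Definition kids t := let: Node _ ts := t in ts.
Definition is_black t := colour t == None.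

(* All vertices of [t], each given as the subtree above it, paired with a
   boolean telling whether its parent is black; [pb] is that boolean for the
   root of [t]. *)
Fixpoint vertices_above (pb : bool) t : seq (bool * bwtree n) :=
  let: Node c ts := t in
  (pb, t) :: flatten [seq vertices_above (c == None) s | s <- ts].

Definition nonroot_vertices t : seq (bool * bwtree n) :=
  flatten [seq vertices_above (is_black t) s | s <- kids t].

Definition vertices t : seq (bwtree n) := t :: [seq u.2 | u <- nonroot_vertices t].

(* The root has at least one flag, the distinguished one. *)
Definition bw_tree t : bool :=
  [&& is_black t, ~~ nilp (kids t)
    & all (fun u => nilp (kids u.2) ==> ~~ is_black u.2) (nonroot_vertices t)].

(* An element [u] of [nonroot_vertices t] also stands for the edge joining the
   vertex [u.2] to its parent, whose ends have colours [u.1] and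
   [is_black u.2]. *)
Definition bipartite t : bool :=
  bw_tree t && all (fun u => u.1 != is_black u.2) (nonroot_vertices t).

Definition no_white_edge t : bool :=
  all (fun u => u.1 || is_black u.2) (nonroot_vertices t).

(* Black vertices of arity 1 and valence 2 are the non-root black vertices with
   exactly one child. *)
Definition no_two_black_edges t : bool :=
  all (fun u => ~~ [&& is_black u.2, size (kids u.2) == 1%N, u.1
                     & all is_black (kids u.2)])
      (nonroot_vertices t).

Definition no_black_edge_and_leaf t : bool :=
  all (fun u => ~~ [&& is_black u.2, size (kids u.2) == 1%N, u.1
                     & all (fun s => nilp (kids s)) (kids u.2)])
      (nonroot_vertices t).

Definition univalent_root_mixed t : bool :=
  (size (kids t) == 1%N) ==> all (fun s => ~~ is_black s) (kids t).

Definition stably_bipartite t : bool :=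
  [&& bw_tree t, no_white_edge t, no_two_black_edges t,
      no_black_edge_and_leaf t & univalent_root_mixed t].

Definition white_labels t : seq 'I_n := pmap colour (vertices t).

Definition well_labelled t : bool := perm_eq (white_labels t) (enum 'I_n).

(* |v| for the white vertex v with label [i] (labels occur once). *)
Definition arity t i : nat :=
  \sum_(s <- vertices t | colour s == Some i) size (kids s).

(* The flags at a white vertex v are, in cyclic order, the outgoing one 0 and
   the incoming ones 1, ..., |v|; its angles are 0, ..., |v|, angle [j] being the
   one from flag [j] to the next flag.  They are effective when |v| > 0.
   [collapse_in i j t] is what replaces [t] in the list of the children of its
   parent when angle [j] of the white vertex with label [i] is collapsed:
   - for 0 < j < |v|, children number j-1 and j of v are merged;
   - for j = 0, the first child of v is merged with the parent of v, and its
     children become siblings of v, immediately before v;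
   - for j = |v|, likewise with the last child, immediately after v.
   If the parent of v is the root, the cut of its cyclic order stays in the same
   place, also when the collapsed angle is next to it. *)
Fixpoint collapse_in i (j : nat) t : seq (bwtree n) :=
  let: Node c ts := t in
  if c == Some i then
    if j == 0%N then
      kids (head t ts) ++ [:: Node c (behead ts)]
    else if j == size ts then
      Node c (take j.-1 ts) :: kids (last t ts)
    else
      [:: Node c (take j.-1 ts
                  ++ Node None (kids (nth t ts j.-1) ++ kids (nth t ts j))
                  :: drop j.+1 ts)]
  else [:: Node c (flatten [seq collapse_in i j s | s <- ts])].

Definition collapse i (j : nat) t : bwtree n := head t (collapse_in i j t).

(* The black edges, each given by the address of its upper end (the path of
   child numbers leading to it from the root), in depth-first planar order. *)
Fixpoint black_edges t : seq (seq nat) :=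
  let: Node c ts := t in
  let above := [seq (if (c == None) && is_black s then [:: [::]] else [::])
                    ++ black_edges s | s <- ts] in
  flatten [seq [seq a :: p | p <- nth [::] above a] | a <- iota 0 (size ts)].

(* Contraction of the edge below the vertex with address [p]. *)
Fixpoint contract_at (p : seq nat) t : bwtree n :=
  if p is a :: p' then
    let: Node c ts := t in
    let s := nth t ts a in
    Node c (take a ts
            ++ (if p' is [::] then kids s else [:: contract_at p' s])
            ++ drop a.+1 ts)
  else t.

Definition contract (e : nat) t : bwtree n :=
  contract_at (nth [::] (black_edges t) e) t.

End Trees.

(** * The indexing sets of cells *)

(* The labels v and 1. *)
Variant height := ht_v | ht_1.
HB.instance Definition _ := gen_eqMixin height.
HB.instance Definition _ := gen_choiceMixin height.

Definition T_bipart (n : nat) : Type :=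
  {t : bwtree n | bipartite t && well_labelled t}.
HB.instance Definition _ n := Choice.on (T_bipart n).

(* The function h on black edges is the sequence of its values along
   [black_edges t].  Collapsing white angles and contracting black edges do not
   change the relative order of the (other) black edges. *)
Definition T_ht (n : nat) : Type :=
  {th : bwtree n * seq height |
    [&& stably_bipartite th.1, well_labelled th.1
      & size th.2 == size (black_edges th.1)]}.
HB.instance Definition _ n := Choice.on (T_ht n).

(** * Cells *)

Section Cells.
Variables (R : realType) (n : nat).

(* The standard k-simplex with coordinates 0, ..., k. *)
Definition simplex (k : nat) : set {ptws nat -> R} :=
  [set x | [/\ forall j, 0 <= x j, forall j, (k < j)%N -> x j = 0
             & \sum_(j < k.+1) x j = 1]].

Definition simplices_space := {ptws 'I_n -> {ptws nat -> R}}.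

Definition simplices (t : bwtree n) : set simplices_space :=
  [set x | forall i, simplex (arity t i) (x i)].

(* I^{E_v}; the coordinates outside of E_v are fixed to 1. *)
Definition cube (h : seq height) : set {ptws nat -> R} :=
  [set y | forall e, match nth ht_1 h e with
                     | ht_v => is_true (0 <= y e <= 1)
                     | ht_1 => y e = 1
                     end].

Definition cell1 (t : T_bipart n) : set simplices_space := simplices (val t).

Definition cell_ht (th : T_ht n) :
    set (simplices_space * {ptws nat -> R})%type :=
  simplices (val th).1 `*` cube (val th).2.

Definition drop_coord (j : nat) (x : {ptws nat -> R}) : {ptws nat -> R} :=
  fun k => x (bump j k).

(* The vertices of the simplex of a white vertex correspond to its angles; the
   face where coordinate [j] vanishes is the one of the tree with angle [j]
   collapsed. *)
Definition angle_face (t : bwtree n) (x : simplices_space)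
    (t' : bwtree n) (x' : simplices_space) : Prop :=
  exists (i : 'I_n) (j : nat),
    [/\ (0 < arity t i)%N, (j <= arity t i)%N, x i j = 0, t' = collapse i j t
      & x' = (fun k => if k == i then drop_coord j (x k) else x k)].

Definition glue1 (u u' : T_bipart n * simplices_space) : Prop :=
  angle_face (val u.1) u.2 (val u'.1) u'.2.

Definition height0_face (t : bwtree n) (h : seq height) (y : {ptws nat -> R})
    (t' : bwtree n) (h' : seq height) (y' : {ptws nat -> R}) : Prop :=
  exists e : nat,
    [/\ nth ht_1 h e = ht_v, y e = 0, t' = contract e t,
        h' = take e h ++ drop e.+1 h & y' = drop_coord e y].

Definition height1_face (h : seq height) (y : {ptws nat -> R})
    (h' : seq height) : Prop :=
  exists e : nat, [/\ nth ht_1 h e = ht_v, y e = 1 & h' = set_nth ht_1 h e ht_1].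

Definition glue_ht
    (u u' : T_ht n * (simplices_space * {ptws nat -> R})) : Prop :=
  let: (th, (x, y)) := u in
  let: (th', (x', y')) := u' in
  let: (t, h) := val th in
  let: (t', h') := val th' in
  [\/ [/\ angle_face t x t' x', h' = h & y' = y],
      height0_face t h y t' h' y' /\ x' = x
    | [/\ height1_face h y h', t' = t, x' = x & y' = y]].

End Cells.

(** * Realization: disjoint union of the closed cells modulo the gluing of
    codimension-one faces, with the quotient topology *)

Section Realization.
Context {I : choiceType} {A : topologicalType}.
Variables (cell : I -> set A) (glue : I * A -> I * A -> Prop).
Local Open Scope quotient_scope.

Definition cell_sum : Type := {i : I & set_type (cell i)}.
HB.instance Definition _ := Topological.on cell_sum.

Definition cell_point (u : cell_sum) : I * A := (projT1 u, val (projT2 u)).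

Definition glue_equiv (u v : cell_sum) : Prop :=
  clos_refl_sym_trans cell_sum
    (fun u v => glue (cell_point u) (cell_point v)) u v.

Definition glue_rel (u v : cell_sum) : bool := `[< glue_equiv u v >].

Lemma glue_rel_refl : reflexive glue_rel.
Proof. by move=> u; apply/asboolP; exact: rst_refl. Qed.

Lemma glue_rel_sym : symmetric glue_rel.
Proof. by move=> u v; apply: asbool_equiv_eq; split; exact: rst_sym. Qed.

Lemma glue_rel_trans : transitive glue_rel.
Proof.
by move=> v u w /asboolP uv /asboolP vw; apply/asboolP; exact: rst_trans uv vw.
Qed.

Definition glue_eqrel := EquivRel _ glue_rel_refl glue_rel_sym glue_rel_trans.

Definition realization := {eq_quot glue_eqrel}.
HB.instance Definition _ := Topological.copy realization
  (quotient_topology realization).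
HB.instance Definition _ := Quotient.on realization.

Lemma realizationP (u v : cell_sum) :
  \pi_realization u = \pi_realization v <-> glue_equiv u v.
Proof. by split=> [/eqmodP/asboolP|?] //; apply/eqmodP/asboolP. Qed.

End Realization.

(** * The two complexes, and the inclusion of the first one in the second one *)

Section BipartiteStable.
Variable n : nat.
Implicit Types t : bwtree n.

Lemma bwtree_nested_ind (P : bwtree n -> Prop) :
  (forall c ts, (forall s, s \in ts -> P s) -> P (Node c ts)) -> forall t, P t.
Proof.
move=> PN; fix IH 1 => -[c ts]; apply: PN.
elim: ts => [|t ts IHts] s; first by clear IH; rewrite in_nil.
by rewrite in_cons => /predU1P[->|]; [exact: IH | exact: IHts].
Qed.

Lemma mixed_black_edges (pb : bool) t :
  all (fun u => u.1 != is_black u.2) (vertices_above pb t) ->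
  black_edges t = [::].
Proof.
elim/bwtree_nested_ind: t pb => c ts IH pb /= /andP[_ /allP mts].
rewrite (_ : map _ ts = [seq [::] | _ <- ts]).
  elim: iota => //= a r ->; rewrite cats0.
  have -> // : nth [::] [seq [::] | _ <- ts] a = [::] :> seq (seq nat).
  by elim: ts a {IH mts} => [|s ts IH] [|a] //=.
apply/eq_in_map => s sts.
have {}mts : all (fun u => u.1 != is_black u.2) (vertices_above (c == None) s).
  apply/allP => u us; apply: mts; apply/flattenP.
  by exists (vertices_above (c == None) s) => //; exact: map_f.
rewrite (IH _ sts _ mts) cats0.
by case: s mts {sts} => c' ts' /= /andP[+ _]; case: (c == None); case: is_black.
Qed.

Lemma bipartite_black_edges t : bipartite t -> black_edges t = [::].
Proof.
case/andP=> /andP[tb _] mt; apply: (@mixed_black_edges false).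
by case: t tb mt => c ts /= tb mt; apply/andP; split => //=; rewrite tb.
Qed.

Lemma bipartite_stably_bipartite t : bipartite t -> stably_bipartite t.
Proof.
case/andP=> bt /allP mt; have /andP[tb _] := bt.
rewrite /stably_bipartite bt /=; apply/and4P; split.
- by apply/allP => u /mt; case: u.1 (is_black _) => [] [].
- by apply/allP => u /mt; case: u.1 (is_black _) => [] [] //; rewrite !andbF.
- by apply/allP => u /mt; case: u.1 (is_black _) => [] [] //; rewrite !andbF.
- apply/implyP => _; apply/allP => s st; have := mt (true, s); apply.
  apply/flattenP; exists (vertices_above (is_black t) s); first exact: map_f.
  by rewrite tb; case: (s) => c ts; rewrite /= in_cons eqxx.
Qed.

Lemma T_ht_of_bipart_subproof (t : T_bipart n) :
  [&& stably_bipartite (val t), well_labelled (val t)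
    & size ([::] : seq height) == size (black_edges (val t))].
Proof.
have /andP[bt ->] := valP t.
by rewrite bipartite_stably_bipartite// bipartite_black_edges.
Qed.

Definition T_ht_of_bipart (t : T_bipart n) : T_ht n :=
  exist _ (val t, [::]) (T_ht_of_bipart_subproof t).

End BipartiteStable.

Section Complexes.
Variables (R : realType) (n : nat).
Local Open Scope quotient_scope.

Definition K1 : topologicalType := realization (@cell1 R n) (@glue1 R n).

Definition Kht : topologicalType := realization (@cell_ht R n) (@glue_ht R n).

Lemma cell_incl_subproof (t : T_bipart n) (x : cell1 t) :
  (val x, (fun=> 1) : {ptws nat -> R}) \in cell_ht (T_ht_of_bipart t).
Proof. by apply/mem_set; split; [exact: set_valP|move=> e /=; case: e]. Qed.

Definition cell_incl (u : cell_sum (@cell1 R n)) : cell_sum (@cell_ht R n) :=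
  existT (fun th => set_type (@cell_ht R n th)) (T_ht_of_bipart (projT1 u))
    (exist _ (val (projT2 u), (fun=> 1) : {ptws nat -> R})
       (cell_incl_subproof (projT2 u))).

Lemma cell_incl_glue (u v : cell_sum (@cell1 R n)) :
  glue_equiv (@glue1 R n) u v ->
  glue_equiv (@glue_ht R n) (cell_incl u) (cell_incl v).
Proof.
elim=> {u v} [u v uv|u|u v _ |u v w _ uv _ vw].
- by apply: rst_step; apply: Or31; split.
- exact: rst_refl.
- exact: rst_sym.
- exact: rst_trans uv vw.
Qed.

Definition K1_incl (q : K1) : Kht := \pi_Kht (cell_incl (repr q)).

Lemma K1_inclE (u : cell_sum (@cell1 R n)) :
  K1_incl (\pi_K1 u) = \pi_Kht (cell_incl u).
Proof.
by apply/realizationP/cell_incl_glue/realizationP; rewrite reprK.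
Qed.

End Complexes.

(** * Strong deformation retracts *)

Definition topological_embedding (X Y : topologicalType) (f : X -> Y) : Prop :=
  [/\ injective f, continuous f
    & forall U : set X, open U -> exists2 V : set Y, open V & U = f @^-1` V].

Definition strong_deformation_retract (R : realType) (X : topologicalType)
    (A : set X) : Prop :=
  exists H : X * R -> X,
    [/\ {within [set: X] `*` `[0, 1], continuous H},
        forall x, H (x, 0) = x,
        forall x, A (H (x, 1))
      & forall a s, A a -> 0 <= s <= 1 -> H (a, s) = a].

(* Main.v *)
From Pilot Require Import Defs.
From Stdlib Require Import Relation_Operators.
From mathcomp Require Import all_boot all_order all_algebra.
From mathcomp Require Import generic_quotient zify.
From mathcomp Require Import all_classical all_reals all_analysis.
(* Again, because the analysis library also has a [contract] and a [glue1]. *)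
Import Pilot.Defs.

(* Shrinking the heights of all black edges linearly to 0, [y |-> (1 - s) y], is
   compatible with all the gluings: every cell [(t, h)] is the face of the cell
   [(t, v, ..., v)] where the edges labelled 1 have height 1.  At [s = 1] all
   heights are 0, so the point is glued to a point of the cell of the tree with all
   black edges contracted, which is bipartite.  Since this full contraction
   commutes with the collapse of angles, it also defines a continuous left
   inverse of the inclusion, which is therefore an embedding.  The homotopy is
   continuous on the product because [R] is locally compact: its curried form,
   with values in the compact-open topology, is continuous on each cell, hence on
   the quotient. *)

Set Implicit Arguments.
Unset Strict Implicit.
Unset Printing Implicit Defensive.

Import Order.TTheory GRing.Theory Num.Theory.
Import numFieldNormedType.Exports.

(** * Contraction of one black edge *)

Section Contraction.
Variable n : nat.
Implicit Types (t s : bwtree n) (ts l r : seq (bwtree n)) (c : option 'I_n).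

(** Stated as a relation without addresses, so that invariants follow by rule induction;
    [contraction_contract_at] links it to the indexed operation. *)
Inductive contraction : bwtree n -> bwtree n -> Prop :=
| contraction_here l us r :
    contraction (Node None (l ++ Node None us :: r)) (Node None (l ++ us ++ r))
| contraction_above c l s s' r : contraction s s' ->
    contraction (Node c (l ++ s :: r)) (Node c (l ++ s' :: r)).

Lemma split_nth (T : Type) (x0 : T) (a : nat) (s : seq T) : (a < size s)%N ->
  s = take a s ++ nth x0 s a :: drop a.+1 s.
Proof. by move=> a_s; rewrite -drop_nth// cat_take_drop. Qed.

Lemma black_edges_node c ts : black_edges (Node c ts) =
  flatten [seq [seq a :: p
    | p <- (if (c == None) && is_black (nth (Node c ts) ts a) then [:: [::]] else [::])
           ++ black_edges (nth (Node c ts) ts a)] | a <- iota 0 (size ts)].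
Proof.
rewrite /=; congr flatten; apply/eq_in_map => a; rewrite mem_iota add0n => /= a_ts.
by rewrite (nth_map (Node c ts)).
Qed.

Lemma black_edges_cons t p : p \in black_edges t -> exists a p', p = a :: p'.
Proof.
by case: t => c ts /flattenP[_ /mapP[a _ ->] /mapP[p' _ ->]]; exists a, p'.
Qed.

Lemma contraction_contract_at p t :
  p \in black_edges t -> contraction t (contract_at p t).
Proof.
elim: p t => [|a p IHp] t; first by move=> /black_edges_cons[? []].
case: t => c ts; rewrite black_edges_node.
move=> /flattenP[_ /mapP[b + ->] /mapP[p' + [ab pp']]].
rewrite -{b}ab -{p'}pp' mem_iota add0n => /= a_ts; rewrite mem_cat => /orP[].
- case: ifP => // /andP[/eqP -> ]; rewrite inE => + /eqP ->.
  move=> /=; set s := nth _ _ _ => sb.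
  rewrite {1}(split_nth (Node None ts) a_ts) -/s.
  by case: s sb => [[?|] us] //= _; exact: contraction_here.
(* The remaining address is nonempty, so the contracted edge lies strictly above [s] and
   [contract_at] recurses into [s]. *)
- move=> p_s; have [b [p' p_eq]] := black_edges_cons p_s.
  rewrite p_eq -p_eq {1}(split_nth (Node c ts) a_ts) /=.
  by apply: contraction_above; exact: IHp.
Qed.

Lemma contraction_colour t t' : contraction t t' -> colour t' = colour t.
Proof. by case. Qed.

Lemma size_black_edges c ts : size (black_edges (Node c ts)) =
  \sum_(s <- ts) ((c == None) && is_black s + size (black_edges s)).
Proof.
rewrite black_edges_node size_flatten /shape -map_comp sumnE big_map.
rewrite [in RHS](big_nth (Node c ts)) /index_iota subn0.
by apply: eq_bigr => a _ /=; rewrite size_map size_cat; case: ifP.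
Qed.

(** Only the contracted edge disappears: its two ends are both black, so the edges inherited by the
    lower end keep their colours. *)
Lemma contraction_size_black_edges t t' : contraction t t' ->
  size (black_edges t) = (size (black_edges t')).+1.
Proof.
elim=> [l us r|c l s s' r ss' IHs]; rewrite !size_black_edges.
  rewrite !big_cat big_cons size_black_edges /=.
  by rewrite add1n addSn addnS.
rewrite !big_cat !big_cons IHs /= /is_black (contraction_colour ss').
by rewrite addnS addSn addnS.
Qed.

(** * Contracting all black edges *)

Fixpoint contract_all t : bwtree n :=
  let: Node c ts := t in
  Node c (flatten [seq if (c == None) && is_black s then kids (contract_all s)
                       else [:: contract_all s] | s <- ts]).

(* What replaces [t] in the list of the children of its parent when all black edges
   are contracted; [pb] tells whether the parent is black. *)
Definition contract_below (pb : bool) t : seq (bwtree n) :=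
  if pb && is_black t then kids (contract_all t) else [:: contract_all t].

Lemma contract_all_node c ts : contract_all (Node c ts) =
  Node c (flatten [seq contract_below (c == None) s | s <- ts]).
Proof. by []. Qed.

(** A black child below a black vertex contributes its contracted children in either case, whether
    its edge is removed beforehand or by [contract_all]. *)
Lemma contract_all_contraction t t' :
  contraction t t' -> contract_all t' = contract_all t.
Proof.
elim=> [l us r|c l s s' r ss' IHs]; rewrite !contract_all_node !map_cat !flatten_cat //.
by rewrite /= /contract_below IHs /is_black (contraction_colour ss').
Qed.

(** This list determines both [arity] and [well_labelled]. Contraction leaves it unchanged: it
    merges black vertices, and a white vertex above which it happens keeps its number of
    children. *)
Definition white_vertices t : seq (option 'I_n * nat) :=
  [seq (colour s, size (kids s)) | s <- vertices t & ~~ is_black s].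

Lemma vertices_above2 pb t : [seq u.2 | u <- vertices_above pb t] = vertices t.
Proof. by case: t => c ts. Qed.

Lemma vertices_node c ts : vertices (Node c ts) =
  Node c ts :: flatten [seq vertices s | s <- ts].
Proof.
rewrite /vertices/= /nonroot_vertices/= map_flatten -map_comp.
by congr (_ :: flatten _); apply/eq_map => s /=; rewrite vertices_above2.
Qed.

Lemma white_vertices_node c ts : white_vertices (Node c ts) =
  (if c == None then [::] else [:: (c, size ts)])
  ++ flatten [seq white_vertices s | s <- ts].
Proof.
rewrite /white_vertices vertices_node.
by case: c => [i|]; rewrite /= filter_flatten map_flatten -!map_comp.
Qed.

Lemma white_vertices_contraction t t' :
  contraction t t' -> white_vertices t' = white_vertices t.
Proof.
elim=> [l us r|c l s s' r ss' IHs]; rewrite !white_vertices_node !map_cat !flatten_cat /=.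
  by rewrite white_vertices_node.
by rewrite /= IHs !size_cat.
Qed.

Lemma arity_white_vertices t i :
  arity t i = \sum_(u <- white_vertices t | u.1 == Some i) u.2.
Proof.
rewrite /arity /white_vertices big_map big_filter_cond /=.
by apply: eq_bigl => -[[j|] ts].
Qed.

Lemma white_labels_white_vertices t :
  white_labels t = pmap fst (white_vertices t).
Proof.
rewrite /white_labels /white_vertices; elim: vertices => //= -[[j|] ts] l IHl //=.
by rewrite IHl.
Qed.

Lemma arity_contraction t t' i : contraction t t' -> arity t' i = arity t i.
Proof.
by move=> tt'; rewrite !arity_white_vertices (white_vertices_contraction tt').
Qed.

Lemma well_labelled_contraction t t' :
  contraction t t' -> well_labelled t' = well_labelled t.
Proof.
move=> tt'; rewrite /well_labelled !white_labels_white_vertices.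
by rewrite (white_vertices_contraction tt').
Qed.

(** Each label occurs exactly once, so the sum defining [arity] has a single term. *)
Lemma arity_kids t i s : well_labelled t -> s \in vertices t ->
  colour s = Some i -> size (kids s) = arity t i.
Proof.
move=> wt st si; rewrite /arity -big_filter.
have s1 : s \in [seq s <- vertices t | colour s == Some i].
  by rewrite mem_filter si eqxx.
have : size [seq s <- vertices t | colour s == Some i] = 1%N.
  have <- : count_mem i (enum 'I_n) = 1%N.
    by rewrite count_uniq_mem ?enum_uniq ?mem_enum.
  rewrite size_filter -(permP wt) /white_labels.
  by elim: (vertices t) => //= -[[j|] us] l -> //=.
case: [seq _ <- _ | _] s1 => [|s' [|? ?]] //; rewrite inE => /eqP <- _.
by rewrite big_seq1.
Qed.

(** * Stability *)

(** White leaves and conditions (1) to (3), gathered at one vertex: this makes stability recursive,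
    while the conditions on the root stay apart in [stably_bipartiteE]. *)
Definition stable_vertex (u : bool * bwtree n) : bool :=
  [&& nilp (kids u.2) ==> ~~ is_black u.2,
      u.1 || is_black u.2,
      ~~ [&& is_black u.2, size (kids u.2) == 1%N, u.1 & all (@is_black n) (kids u.2)]
    & ~~ [&& is_black u.2, size (kids u.2) == 1%N, u.1
           & all (fun s => nilp (kids s)) (kids u.2)]].

Definition stable (pb : bool) t : bool :=
  all stable_vertex (vertices_above pb t).

Lemma all_flatten (T : Type) (P : pred T) (ss : seq (seq T)) :
  all P (flatten ss) = all (all P) ss.
Proof. by elim: ss => //= s ss <-; rewrite all_cat. Qed.

Lemma stable_node pb c ts : stable pb (Node c ts) =
  stable_vertex (pb, Node c ts) && all (stable (c == None)) ts.
Proof. by rewrite /stable/= all_flatten all_map. Qed.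

Lemma stably_bipartiteE t : stably_bipartite t =
  [&& is_black t, ~~ nilp (kids t), all (stable true) (kids t)
    & univalent_root_mixed t].
Proof.
rewrite /stably_bipartite /bw_tree /no_white_edge /no_two_black_edges.
rewrite /no_black_edge_and_leaf -!andbA.
case tb: (is_black t) => //=; case: nilp => //=.
rewrite !andbA -!all_predI; congr (_ && _).
rewrite /nonroot_vertices all_flatten all_map tb.
by apply: eq_all => s /=; apply: eq_all => u /=; rewrite -!andbA.
Qed.

(* If a single child is left, then [l] and [r] are empty and it is the only child of
   [Node None us], so that conditions (2) and (3) at that vertex apply. *)
Lemma stable_merge l us r :
  all (stable true) (l ++ Node None us :: r) ->
  [/\ all (stable true) (l ++ us ++ r), ~~ nilp (l ++ us ++ r)
    & size (l ++ us ++ r) = 1%N ->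
      ~~ all (@is_black n) (l ++ us ++ r)
      /\ ~~ all (fun s => nilp (kids s)) (l ++ us ++ r)].
Proof.
rewrite !all_cat /= stable_node => /and3P[-> /andP[/and4P[/= us0 _ A B] -> ->]].
move: us0 A B; case: us => [|u us]//= _ A B; split=> //.
  by case: l.
case: l r us A B => [|? l] r us A B; last by rewrite size_cat /= addnS.
case: r A B => [|? r] A B; last by rewrite /= !size_cat/= addnS.
by case: us A B => //= A B _; rewrite !andbT in A B *; split.
Qed.

(** The black vertex that is merged into its parent has children, so contraction never creates a
    leaf. Condition (3) at the vertex below depends on this. *)
Lemma contraction_nilp pb t t' : contraction t t' -> stable pb t ->
  nilp (kids t') = nilp (kids t).
Proof.
case=> [l us r|c l s s' r _]; last by case: l.
rewrite stable_node => /andP[_ /stable_merge[_ /negbTE -> _]].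
by case: l.
Qed.

(** The merged vertex is handled by [stable_merge]. At any other vertex the number of children,
    their colours and which of them are leaves do not change. *)
Lemma stable_contraction pb t t' : contraction t t' -> stable pb t -> stable pb t'.
Proof.
move=> tt'; elim: tt' pb => [l us r|c l s s' r ss' IHs] pb.
  rewrite !stable_node => /andP[/= + st].
  have [-> us0 us1] := stable_merge st.
  rewrite andbT => /and4P[_ _ _ _]; apply/and4P; split=> //=.
  - by rewrite orbT.
  - by apply/negP => /and3P[/eqP /us1[/negP]].
  - by apply/negP => /and3P[/eqP /us1[_ /negP]].
rewrite !stable_node !all_cat/= => /andP[+ /and3P[-> ss ->]].
rewrite IHs// andbT /stable_vertex /= !all_cat /= !size_cat /= /nilp !size_cat /=.
have := contraction_nilp ss' ss; rewrite /nilp => ->; rewrite !addnS /= andbT.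
by rewrite /is_black (contraction_colour ss').
Qed.

Lemma stably_bipartite_contraction t t' :
  contraction t t' -> stably_bipartite t -> stably_bipartite t'.
Proof.
move=> tt'; rewrite !stably_bipartiteE /univalent_root_mixed.
case: tt' => [l us r|c l s s' r ss'] /=.
  case/andP=> _ /andP[/stable_merge[-> -> us1] _] /=.
  (* Condition (2) at the contracted vertex becomes condition (4) at the root: a single remaining
     child is white. *)
  apply/implyP => /eqP X1; have [+ _] := us1 X1.
  by case: (l ++ us ++ r) X1 {us1} => [|s []] //= _; rewrite !andbT.
rewrite !all_cat /= => /and4P[cb _ /and3P[-> ss ->]] /=.
rewrite [is_black (Node _ _)]cb (stable_contraction ss' ss) /= /nilp !size_cat /= addnS /=.
by rewrite /is_black (contraction_colour ss').
Qed.

Lemma contraction_contract e t : (e < size (black_edges t))%N ->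
  contraction t (contract e t).
Proof. by move=> et; apply/contraction_contract_at/mem_nth. Qed.

(** Induction on the number of black edges. Contracting always edge number 0 means that a list of
    heights just loses its head. *)
Lemma stably_bipartite_ind (P : bwtree n -> Prop) :
  (forall t, stably_bipartite t -> black_edges t = [::] -> P t) ->
  (forall t, stably_bipartite t -> (0 < size (black_edges t))%N ->
    P (contract 0 t) -> P t) ->
  forall t, stably_bipartite t -> P t.
Proof.
move=> P0 PS t; move: {2}(size _) (erefl (size (black_edges t))) => k.
elim: k t => [|k IHk] t tk st; first by apply: P0 => //; apply/size0nil.
have t0 : (0 < size (black_edges t))%N by rewrite tk.
have tt' := contraction_contract t0.
apply: PS => //; apply: IHk; last exact: stably_bipartite_contraction tt' st.
by apply/succn_inj; rewrite -tk (contraction_size_black_edges tt').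
Qed.

Lemma black_edges_nil c ts : black_edges (Node c ts) = [::] ->
  forall s, s \in ts -> ((c == None) && is_black s) = false /\ black_edges s = [::].
Proof.
move/(congr1 size); rewrite size_black_edges /= => /eqP.
rewrite sum_nat_seq_eq0 => /allP ts0 s /ts0 /=.
by rewrite addn_eq0 => /andP[]; case: (_ && _) => // _ /nilP.
Qed.

(** Stability excludes white edges. The last hypothesis covers the edge below [t], which
    [black_edges t] does not list. *)
Lemma stable_mixed pb t : stable pb t -> black_edges t = [::] ->
  ~~ (pb && is_black t) -> all (fun u => u.1 != is_black u.2) (vertices_above pb t).
Proof.
elim/bwtree_nested_ind: t pb => c ts IH pb.
rewrite stable_node => /andP[/and4P[_ /= pbt _ _] /allP sts] /black_edges_nil bts.
move=> pbt'; apply/andP; split; first by move: pbt pbt'; case: pb; case: is_black.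
rewrite all_flatten all_map; apply/allP => s /= s_ts.
have [/negbT cs bs] := bts _ s_ts.
by apply: IH => //; exact: sts.
Qed.

Lemma stably_bipartite_bipartite t :
  stably_bipartite t -> black_edges t = [::] -> bipartite t.
Proof.
move=> st bt; rewrite /bipartite; have /andP[-> _] := st.
move: st; rewrite stably_bipartiteE => /and4P[].
case: t bt => c ts /black_edges_nil bt tb _ /allP sts _.
rewrite /nonroot_vertices tb all_flatten all_map; apply/allP => s /= s_ts.
apply: stable_mixed; [exact: sts|by have [] := bt _ s_ts|].
by have [/negbT] := bt _ s_ts; move: tb; rewrite /is_black /= => ->.
Qed.

Lemma contract_all_id t : black_edges t = [::] -> contract_all t = t.
Proof.
elim/bwtree_nested_ind: t => c ts IH /black_edges_nil bt.
rewrite contract_all_node; congr Node.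
rewrite -[RHS]flatten_seq1; congr flatten; apply/eq_in_map => s s_ts.
by have [cs bs] := bt _ s_ts; rewrite /contract_below cs IH.
Qed.

Lemma contract_all_stably_bipartite t : stably_bipartite t ->
  [/\ bipartite (contract_all t), well_labelled (contract_all t) = well_labelled t
    & forall i, arity (contract_all t) i = arity t i].
Proof.
elim/stably_bipartite_ind: t / => t st bt.
  by rewrite contract_all_id//; split=> //; exact: stably_bipartite_bipartite.
have tt' := contraction_contract bt.
rewrite (contract_all_contraction tt') (well_labelled_contraction tt') => -[-> -> ti].
by split=> // i; rewrite ti (arity_contraction _ tt').
Qed.

(** * Contraction commutes with the collapse of an angle *)

Lemma kids_contract_all s : is_black s ->
  kids (contract_all s) = flatten [seq contract_below true u | u <- kids s].
Proof. by case: s => [[]]. Qed.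

Lemma contract_below_false ts :
  flatten [seq contract_below false s | s <- ts] = map contract_all ts.
Proof. exact: flatten_map1. Qed.

Lemma contract_below_white i ts l :
  flatten [seq contract_below true s | s <- Node (Some i) ts :: l] =
  Node (Some i) (map contract_all ts) :: flatten [seq contract_below true s | s <- l].
Proof. by rewrite /= contract_below_false. Qed.

Lemma contract_all_black ts :
  contract_all (Node None ts) = Node None (flatten [seq contract_below true s | s <- ts]).
Proof. by []. Qed.

(** Reduces the commutation of two substitutions of lists for elements to the case of one
    element. *)
Lemma flatten_map_comm (T : eqType) (f g : T -> seq T) (s : seq T) :
  (forall x, x \in s -> flatten (map f (g x)) = flatten (map g (f x))) ->
  flatten (map f (flatten (map g s))) = flatten (map g (flatten (map f s))).
Proof.
elim: s => //= x s IHs fg; rewrite !map_cat !flatten_cat fg ?mem_head//.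
by rewrite IHs// => y ys; apply: fg; rewrite inE ys orbT.
Qed.

Lemma subvertices (P : bwtree n -> Prop) c ts s :
  (forall u, u \in vertices (Node c ts) -> P u) -> s \in ts ->
  forall u, u \in vertices s -> P u.
Proof.
move=> Pts s_ts u us; apply: Pts; rewrite vertices_node inE; apply/orP; right.
by apply/flattenP; exists (vertices s) => //; exact: map_f.
Qed.

(** Both operations replace a child by a list of siblings, hence the form with lists. Away from the
    label [i] the claim passes to the children. At that label all children are black by stability,
    merging concatenates their lists of children, and full contraction respects concatenation. *)
Lemma contract_all_collapse_in pb i j t : stable pb t ->
  (forall s, s \in vertices t -> colour s = Some i -> (j <= size (kids s))%N) ->
  flatten [seq contract_below pb s | s <- collapse_in i j t] =
  flatten [seq collapse_in i j s | s <- contract_below pb t].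
Proof.
elim/bwtree_nested_ind: t pb => c ts IH pb; rewrite stable_node => /andP[st /allP sts] jt.
have [ci|ci] := eqVneq c (Some i); last first.
  have -> : collapse_in i j (Node c ts) =
      [:: Node c (flatten [seq collapse_in i j s | s <- ts])].
    by rewrite /= (negbTE ci).
  have eq_ts := @flatten_map_comm _ (contract_below (c == None)) (collapse_in i j) ts.
  have {}eq_ts := eq_ts (fun s s_ts => IH s s_ts _ (sts s s_ts) (subvertices jt s_ts)).
  rewrite /= /contract_below /is_black /= -/(is_black _).
  case: ifP => _; rewrite /= cats0 eq_ts//.
  by rewrite (negbTE ci).
have sb s : s \in ts -> is_black s.
  by move/sts; rewrite ci; case: s => c' us; rewrite stable_node => /andP[/and4P[]].
have {IH} jt : (j <= size ts)%N.
  by apply: (jt (Node c ts)) => //; rewrite vertices_node inE eqxx.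
(* White edges are excluded, so the parent is black: the children released beside the vertex by its
   first or last angle are then contracted as they were below their black parent. *)
have {st} -> : pb = true by move: st; rewrite ci => /and4P[_ + _ _]; case: pb.
have -> : contract_below true (Node c ts) = [:: Node (Some i) (map contract_all ts)].
  by rewrite ci; exact: (contract_below_white i ts [::]).
rewrite {}ci {sts} /= cats0 eqxx size_map.
case: ifP => [_|/negbT j0].
  rewrite map_cat flatten_cat contract_below_white behead_map.
  (* For a leaf, [head] returns its default, the leaf itself, which has no children; both sides are
     then just the leaf. *)
  case: ts sb jt => [//|s ts] sb _ /=.
  by rewrite kids_contract_all// sb// mem_head.
case: ifP => [/eqP j_ts|/negbT j_ts].
  rewrite contract_below_white map_take; congr (_ :: _).
  case: ts sb j_ts j0 {jt} => [|s ts] sb j_ts; first by rewrite j_ts.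
  by rewrite /= last_map kids_contract_all// sb// mem_last.
have {j_ts} jt : (j < size ts)%N by rewrite ltn_neqAle j_ts.
have j1t : (j.-1 < size ts)%N by apply: leq_ltn_trans jt; exact: leq_pred.
rewrite contract_below_white map_cat map_take map_cons map_drop contract_all_black.
rewrite map_cat flatten_cat -!kids_contract_all ?sb ?mem_nth//.
by rewrite !(nth_map (Node (Some i) ts)).
Qed.

Lemma contract_all_collapse i j t : stably_bipartite t -> well_labelled t ->
  (j <= arity t i)%N -> contract_all (collapse i j t) = collapse i j (contract_all t).
Proof.
rewrite stably_bipartiteE /collapse => /and4P[+ _ + _].
case: t => [[//|ts]] _ /allP sts wt ji.
have jt u : u \in vertices (Node None ts) -> colour u = Some i -> (j <= size (kids u))%N.
  by move=> ut ui; rewrite (arity_kids wt ut ui).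
rewrite /=; congr Node; apply: (@flatten_map_comm _ (contract_below true)) => s s_ts.
by apply: contract_all_collapse_in; [exact: sts|exact: (subvertices jt)].
Qed.

Lemma contract_all_bipartite t : bipartite t -> contract_all t = t.
Proof. by move/bipartite_black_edges/contract_all_id. Qed.

End Contraction.

Local Open Scope classical_set_scope.
Local Open Scope ring_scope.
Local Open Scope quotient_scope.

(** * Continuity on realizations *)

Lemma ptws_continuous (I : Type) (X Y : topologicalType) (f : X -> {ptws I -> Y}) :
  (forall i, continuous (fun x => f x i)) -> continuous f.
Proof.
move=> cf x; apply/cvg_sup => i.
by apply: continuous_comp_initial; exact: cf.
Qed.

Lemma eval_continuous (I : eqType) (Y : topologicalType) (i : I) :
  continuous (fun f : {ptws I -> Y} => f i).
Proof. exact: (@proj_continuous I (fun=> Y) i). Qed.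

Section RealizationTheory.
Context {I : choiceType} {A : topologicalType}.
Variables (cell : I -> set A) (glue : I * A -> I * A -> Prop).

Definition cell_at (i : I) (a : A) (ia : a \in cell i) : cell_sum cell :=
  existT (fun i => set_type (cell i)) i (exist _ a ia).

Lemma cell_at_continuous (X : topologicalType) (i : I) (f : X -> A)
    (fi : forall x, f x \in cell i) :
  continuous f -> continuous (fun x => cell_at (fi x)).
Proof.
move=> cf; pose g x : set_type (cell i) := exist _ (f x) (fi x).
have cg : continuous g.
  exact: (@continuous_comp_initial (set_type (cell i)) X A set_val).
move=> x; apply: (@continuous_comp X (set_type (cell i)) (cell_sum cell) g
  (existT (fun i => set_type (cell i)) i)); first exact: cg.
exact: existT_continuous.
Qed.

(** Lets equality in the dependent sum be checked on index and underlying point, without transport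
    between cells. *)
Lemma cell_point_inj : injective (@cell_point I A cell).
Proof.
move=> [i a] [j b]; rewrite /cell_point /= => -[ij]; case: _ / ij b => b ab.
by congr existT; exact: val_inj.
Qed.

Lemma cell_sum_continuous (Z : topologicalType) (f : cell_sum cell -> Z) :
  (forall i, continuous (fun a : set_type (cell i) => f (existT _ i a))) -> continuous f.
Proof.
move=> cf; rewrite (_ : f = unstable.sigT_fun (fun i a => f (existT _ i a))).
  exact: sigT_continuous.
by apply/funext => -[].
Qed.

Lemma realization_continuous (Z : topologicalType) (f : realization cell glue -> Z) :
  (forall i, continuous (fun a : set_type (cell i) => 
    f (\pi_(realization cell glue) (existT _ i a : cell_sum cell)))) ->
  continuous f.
Proof.
by move=> cf; apply/quotient_continuous; exact: (@cell_sum_continuous _ (f \o \pi_(realization cell glue))).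
Qed.

Lemma glue_equiv_step (u v : cell_sum cell) :
  glue (cell_point u) (cell_point v) -> glue_equiv glue u v.
Proof. exact: rst_step. Qed.

End RealizationTheory.

(** * The retraction *)

Section Retraction.
Variables (R : realType) (n : nat).

Implicit Types (th : T_ht n).

Local Notation cell_sum1 := (cell_sum (@cell1 R n)).
Local Notation cell_sumht := (cell_sum (@cell_ht R n)).
Local Notation equiv1 := (glue_equiv (@glue1 R n)).
Local Notation equivht := (glue_equiv (@glue_ht R n)).

Lemma nth_ht_v (h : seq height) e : nth ht_1 h e = ht_v -> (e < size h)%N.
Proof. by case: ltnP => // he; rewrite nth_default. Qed.

Lemma T_ht_contract_all_subproof th :
  bipartite (contract_all (val th).1) && well_labelled (contract_all (val th).1).
Proof.
have /and3P[st wt _] := valP th.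
by have [-> -> _] := contract_all_stably_bipartite st; rewrite wt.
Qed.

Definition T_ht_contract_all th : T_bipart n :=
  exist _ (contract_all (val th).1) (T_ht_contract_all_subproof th).

Lemma arity_contract_all th i :
  arity (contract_all (val th).1) i = arity (val th).1 i.
Proof.
have /and3P[st _ _] := valP th.
by have [_ _ ->] := contract_all_stably_bipartite st.
Qed.

Lemma retract_subproof th (a : set_type (@cell_ht R n th)) :
  (val a).1 \in cell1 (T_ht_contract_all th).
Proof. by apply/mem_set; have [+ _] := set_valP a => a1 i; rewrite arity_contract_all. Qed.

(** The heights are dropped; the simplex coordinates can be kept because contraction preserves the
    arities of white vertices. *)
Definition retract (u : cell_sumht) : cell_sum1 :=
  cell_at (retract_subproof (projT2 u)).

Lemma eq_retract (u v : cell_sumht) :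
  contract_all (val (projT1 u)).1 = contract_all (val (projT1 v)).1 ->
  (val (projT2 u)).1 = (val (projT2 v)).1 -> equiv1 (retract u) (retract v).
Proof.
move=> tuv xuv; have -> : retract u = retract v; last exact: rst_refl.
by apply: cell_point_inj; rewrite /cell_point /= xuv; congr pair; exact: val_inj.
Qed.

(** Angle faces go to angle faces because contraction commutes with collapse. The two kinds of
    height faces only change data that [retract] forgets. *)
Lemma retract_glue (u v : cell_sumht) :
  glue_ht (cell_point u) (cell_point v) -> equiv1 (retract u) (retract v).
Proof.
case: u v => [[[t h] th] [[x y] uxy]] [[[t' h'] th'] [[x' y'] vxy]].
rewrite /glue_ht /cell_point /=; case.
- case=> -[i [j [ti ji xij tt' xx']]] hh' yy'; apply: glue_equiv_step.
  have /and3P[/= st wt _] := th.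
  have [_ _ tti] := contract_all_stably_bipartite st.
  by exists i, j; rewrite tti; split=> //=; rewrite tt' contract_all_collapse.
- case=> -[e [he ye tt' hh' yy'] xx'].
  apply: eq_retract => //=.
  rewrite tt' (contract_all_contraction (contraction_contract _))//.
  have /and3P[_ _ /eqP /= <-] := th.
  exact: nth_ht_v.
- case=> _ tt' xx' _.
  by apply: eq_retract; rewrite //= tt'.
Qed.

Lemma retract_equiv (u v : cell_sumht) : equivht u v -> equiv1 (retract u) (retract v).
Proof.
elim=> {u v} [u v /retract_glue//|u|u v _ uv|u v w _ uv _ vw].
- exact: rst_refl.
- exact: rst_sym.
- exact: rst_trans uv vw.
Qed.

Definition Kht_retract (q : Kht R n) : K1 R n := \pi_(K1 R n) (retract (repr q)).

Lemma Kht_retractE (u : cell_sumht) :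
  Kht_retract (\pi_(Kht R n) u) = \pi_(K1 R n) (retract u).
Proof. by apply/realizationP/retract_equiv/realizationP; rewrite reprK. Qed.

Lemma val_continuous (Y : topologicalType) (B : set Y) :
  continuous (fun b : set_type B => val b).
Proof. exact: initial_continuous. Qed.

Lemma Kht_retract_continuous : continuous Kht_retract.
Proof.
apply/quotient_continuous.
rewrite (_ : _ \o _ = \pi_(K1 R n) \o retract); last first.
  by apply/funext => u; exact: Kht_retractE.
move=> u; apply: continuous_comp; last exact: pi_continuous.
apply: cell_sum_continuous => th.
apply: (@cell_at_continuous _ _ _ _ _ _ (@retract_subproof th)) => a.
by apply: (cvg_comp _ _ (@val_continuous _ _ a)); exact: cvg_fst.
Qed.

Lemma K1_incl_continuous : continuous (@K1_incl R n).
Proof.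
apply/quotient_continuous.
rewrite (_ : _ \o _ = \pi_(Kht R n) \o @cell_incl R n); last first.
  by apply/funext => u; exact: K1_inclE.
move=> u; apply: continuous_comp; last exact: pi_continuous.
apply: cell_sum_continuous => t.
apply: (@cell_at_continuous _ _ _ _ _ _ (@cell_incl_subproof R n t)) => a.
exact: (cvg_pair (@val_continuous _ _ a) (cvg_cst _)).
Qed.

Lemma K1_inclK : cancel (@K1_incl R n) Kht_retract.
Proof.
move=> q; rewrite -[q]reprK K1_inclE Kht_retractE; congr (\pi_(K1 R n) _).
apply: cell_point_inj; case: (repr q) => [[t bt] x]; rewrite /cell_point /=.
congr pair; apply: val_inj => /=; apply: contract_all_bipartite.
by have /andP[] := bt.
Qed.

Lemma K1_incl_embedding : topological_embedding (@K1_incl R n).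
Proof.
split; [exact: can_inj K1_inclK|exact: K1_incl_continuous|].
move=> U oU; exists (Kht_retract @^-1` U).
  by move/continuousP : Kht_retract_continuous; apply.
by apply/seteqP; split=> q /=; rewrite K1_inclK.
Qed.

(** * The homotopy *)

(* Clamping the time extends the homotopy to all of [R], which is locally compact. *)
Definition clamp (s : R) : R := Num.max 0 (Num.min s 1).

Lemma clamp_itv s : 0 <= clamp s <= 1.
Proof. by rewrite /clamp le_max lexx ge_max ler01 ge_min lexx orbT. Qed.

Lemma clamp_id s : 0 <= s <= 1 -> clamp s = s.
Proof. by case/andP=> s0 s1; rewrite /clamp min_l// max_r. Qed.

Lemma clamp_continuous : continuous clamp.
Proof.
move=> s; apply: (@continuous_max R R (cst 0) (fun s => Num.min s 1)).
  exact: cst_continuous.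
apply: (@continuous_min R R id (cst 1)); first exact: id.
exact: cst_continuous.
Qed.

(* [cube] fixes to 1 the coordinates outside of E_v. *)
Definition scale_heights (k : nat) (s : R) (y : {ptws nat -> R}) : {ptws nat -> R} :=
  fun e => if (e < k)%N then (1 - clamp s) * y e else 1.

Lemma cube_itv h (y : {ptws nat -> R}) e : cube h y -> 0 <= y e <= 1.
Proof. by move=> /(_ e); case: nth => [//|->]; rewrite ler01 lexx. Qed.

Lemma cube_nseq k (y : {ptws nat -> R}) :
  (forall e, (e < k)%N -> 0 <= y e <= 1) -> (forall e, (k <= e)%N -> y e = 1) ->
  cube (nseq k ht_v) y.
Proof. by move=> yk y1 e; rewrite nth_nseq; case: ltnP => [/yk|/y1]. Qed.

Lemma cube_scale_heights h s (y : {ptws nat -> R}) : cube h y ->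
  cube (nseq (size h) ht_v) (scale_heights (size h) s y).
Proof.
move=> hy; apply: cube_nseq => e; rewrite /scale_heights; last by case: ltnP.
move=> ->; have /andP[y0 y1] := cube_itv e hy; have /andP[s0 s1] := clamp_itv s.
by rewrite mulr_ge0 ?subr_ge0//= mulr_ile1 ?subr_ge0// lerBlDr lerDl.
Qed.

Lemma all_v_subproof th :
  [&& stably_bipartite (val th).1, well_labelled (val th).1
    & size (nseq (size (val th).2) ht_v) == size (black_edges (val th).1)].
Proof. by rewrite size_nseq; exact: valP th. Qed.

Definition all_v th : T_ht n :=
  exist _ ((val th).1, nseq (size (val th).2) ht_v) (all_v_subproof th).

Lemma shrink_subproof th (a : set_type (@cell_ht R n th)) s :
  ((val a).1, scale_heights (size (val th).2) s (val a).2)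
    \in cell_ht (all_v th).
Proof.
by apply/mem_set; have [xp yp] := set_valP a; split=> //=; exact: cube_scale_heights.
Qed.

Definition shrink (u : cell_sumht) (s : R) : cell_sumht :=
  cell_at (shrink_subproof (projT2 u) s).

Lemma eq_cell_point (u v : cell_sumht) : cell_point u = cell_point v -> equivht u v.
Proof. by move/cell_point_inj ->; exact: rst_refl. Qed.

(** As [e < k], the map [bump e] sends indices below [k.-1] below [k], and the other indices to [k]
    or beyond. *)
Lemma scale_heights_drop k e s (y : {ptws nat -> R}) : (e < k)%N ->
  scale_heights k.-1 s (drop_coord e y) = drop_coord e (scale_heights k s y).
Proof.
move=> ek; apply/funext => j; rewrite /scale_heights /drop_coord /bump.
congr (if _ then _ else _).
by case: leqP; lia.
Qed.

(** Scaling fixes the height 0, so height-0 faces go to height-0 faces. The two sides of a height-1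
    gluing have the same tree and coordinates, so they shrink to the same point. *)
Lemma shrink_glue s (u v : cell_sumht) :
  glue_ht (cell_point u) (cell_point v) -> equivht (shrink u s) (shrink v s).
Proof.
case: u v => [[[t h] th] [[x y] uxy]] [[[t' h'] th'] [[x' y'] vxy]].
rewrite /glue_ht /cell_point /=; case.
- by case=> tt' hh' yy'; apply: glue_equiv_step; apply: Or31; split; rewrite //= ?hh' ?yy'.
- case=> -[e [he ye tt' hh' yy'] xx']; apply: glue_equiv_step.
  have eh := nth_ht_v he.
  have sh' : size h' = (size h).-1.
    by rewrite hh' size_cat size_take size_drop eh; lia.
  apply: Or32; split=> //=; exists e; split=> //.
  + by rewrite nth_nseq eh.
  + by rewrite /scale_heights ye mulr0 eh.
  + by rewrite take_nseq ?drop_nseq -?nseqD 1?ltnW//; congr nseq; lia.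
  + by rewrite sh' yy' scale_heights_drop.
- case=> -[e [he ye hh']] tt' xx' yy'; apply: eq_cell_point.
  have sh' : size h' = size h by rewrite hh' size_set_nth; apply/maxn_idPr/nth_ht_v.
  by congr pair; [apply: val_inj|]; rewrite /= ?tt' ?sh' ?xx' ?yy'.
Qed.

Lemma shrink_equiv s (u v : cell_sumht) :
  equivht u v -> equivht (shrink u s) (shrink v s).
Proof.
elim=> {u v} [u v /shrink_glue//|u|u v _ uv|u v w _ uv _ vw].
- exact: rst_refl.
- exact: rst_sym.
- exact: rst_trans uv vw.
Qed.

Definition homotopy (q : Kht R n) (s : R) : Kht R n :=
  \pi_(Kht R n) (shrink (repr q) s).

Lemma homotopyE (u : cell_sumht) s :
  homotopy (\pi_(Kht R n) u) s = \pi_(Kht R n) (shrink u s).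
Proof. by apply/realizationP/shrink_equiv/realizationP; rewrite reprK. Qed.

Lemma scale_heights_continuous k :
  continuous (fun p : R * {ptws nat -> R} => scale_heights k p.1 p.2).
Proof.
apply: ptws_continuous => e; rewrite /scale_heights; case: (e < k)%N; last first.
  exact: cst_continuous.
have c1 : continuous (fun p : R * {ptws nat -> R} => clamp p.1).
  move=> p; apply: (@continuous_comp (R * {ptws nat -> R})%type R R fst clamp).
    exact: cvg_fst.
  exact: clamp_continuous.
have c2 : continuous (fun p : R * {ptws nat -> R} => p.2 e).
  move=> p; apply: (@continuous_comp (R * {ptws nat -> R})%type {ptws nat -> R} R
    snd (fun y => y e)); first exact: cvg_snd.
  exact: eval_continuous.
move=> p; exact: (cvgM (cvgB (cvg_cst (1 : R)) (c1 p)) (c2 p)).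
Qed.

Lemma shrink_cell_continuous th :
  continuous (fun p : set_type (@cell_ht R n th) * R => shrink (existT _ th p.1) p.2).
Proof.
suff : continuous (fun p : set_type (@cell_ht R n th) * R =>
    ((val p.1).1, scale_heights (size (val th).2) p.2 (val p.1).2)).
  exact: (@cell_at_continuous _ _ _ (set_type (@cell_ht R n th) * R)%type _ _
    (fun p => shrink_subproof p.1 p.2)).
move=> p.
pose f (p : set_type (@cell_ht R n th) * R) := val p.1.
have cf : continuous f.
  move=> q; apply: (@continuous_comp _ (set_type (@cell_ht R n th)) _ fst); first exact: cvg_fst.
  exact: val_continuous.
have c1 : continuous (fun p => (f p).1).
  by move=> q; apply: continuous_comp; [exact: cf|exact: cvg_fst].
have c2 : continuous (fun p => (f p).2).
  by move=> q; apply: continuous_comp; [exact: cf|exact: cvg_snd].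
have c3 : continuous (fun p => scale_heights (size (val th).2) (p : _ * R).2 (f p).2).
  move=> q; apply: (@continuous_comp _ (R * {ptws nat -> R})%type _ (fun p => (p.2, (f p).2))
    (fun q => scale_heights (size (val th).2) q.1 q.2)).
    exact: (cvg_pair cvg_snd (c2 q)).
  exact: scale_heights_continuous.
exact: (cvg_pair (c1 p) (c3 p)).
Qed.

Lemma homotopy_continuous : continuous (uncurry homotopy).
Proof.
pose Z := {compact-open, R -> Kht R n}.
have cell_cts th : continuous (fun p : set_type (@cell_ht R n th) * R =>
    \pi_(Kht R n) (shrink (existT _ th p.1) p.2)).
  move=> p; apply: (cvg_comp _ _ (@shrink_cell_continuous th p)).
  exact: pi_continuous.
(* What remains is continuity of the curried map, checked on cells, and of the path of each single
   point. *)
apply: continuous_uncurry; [exact: locally_compactR|exact: Rhausdorff| |].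
  apply: (@realization_continuous _ _ _ _ Z) => th.
  rewrite (_ : (fun _ => _) = curry (fun p : set_type (@cell_ht R n th) * R =>
    \pi_(Kht R n) (shrink (existT _ th p.1) p.2))).
    exact: continuous_curry_fun (cell_cts th).
  by apply/funext => a; apply/funext => s; exact: homotopyE.
move=> q; rewrite -[q]reprK; case: (repr q) => th a.
rewrite (_ : homotopy _ = fun s => \pi_(Kht R n) (shrink (existT _ th a) s)).
  by have [_ /(_ a)] := continuous_curry (cell_cts th).
by apply/funext => s; exact: homotopyE.
Qed.

(** * The homotopy at time 0 and on the bipartite subcomplex *)

Lemma T_ht_set_v_subproof th e : (e < size (val th).2)%N ->
  [&& stably_bipartite (val th).1, well_labelled (val th).1
    & size (set_nth ht_1 (val th).2 e ht_v) == size (black_edges (val th).1)].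
Proof. by move=> eh; rewrite size_set_nth (maxn_idPr eh); exact: valP th. Qed.

(** At time 0 only labels change, from 1 to v. By induction on the number of labels 1, each change
    is undone by one height-1 gluing. *)
Lemma shrink0 (u : cell_sumht) : equivht (shrink u 0) u.
Proof.
have clamp0 : clamp 0 = 0 by rewrite clamp_id// lexx ler01.
move: {2}(count_mem ht_1 _) (erefl (count_mem ht_1 (val (projT1 u)).2)) => m.
elim: m u => [|m IHm] [[[t h] th] [[x y] uxy]] /= hm.
  have hv : h = nseq (size h) ht_v.
    apply/all_pred1P/allP => -[]//= h1; move/eqP: hm.
    by rewrite eqn0Ngt -has_count has_pred1 h1.
  apply: eq_cell_point; rewrite /cell_point /=; congr pair.
    by apply: val_inj; rewrite /= -hv.
  congr pair; apply/funext => e; rewrite /scale_heights clamp0 subr0 mul1r.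
  case: ltnP => // he; have [_ /= /(_ e)] := set_mem uxy.
  by rewrite nth_default.
have h1 : ht_1 \in h by rewrite -has_pred1 has_count hm.
pose e := index ht_1 h.
have eh : (e < size h)%N by rewrite index_mem.
have he : nth ht_1 h e = ht_1 by rewrite nth_index.
pose h' := set_nth ht_1 h e ht_v.
have sh' : size h' = size h by rewrite size_set_nth (maxn_idPr eh).
pose th' : T_ht n := exist _ (t, h') (@T_ht_set_v_subproof (exist _ (t, h) th) e eh).
have uxy' : (x, y) \in cell_ht th'.
  apply/mem_set; have [/= xt yh] := set_mem uxy; split=> // i /=.
  rewrite nth_set_nth /=; case: eqP => [->|_]; last exact: yh.
  exact: cube_itv yh.
have : equivht (shrink (cell_at uxy') 0) (cell_at uxy').
  apply: IHm; rewrite /= count_set_nth_ltn//= he hm eqxx.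
  by rewrite (_ : ht_v == ht_1 = false) ?addn0 ?subn1//; apply/eqP.
(* [shrink] sees only the number of labels, not their values, so relabelling edge [e] does not
   affect it. *)
have -> : shrink (cell_at uxy') 0 =
    shrink (existT _ (exist _ (t, h) th) (exist _ (x, y) uxy)) 0.
  apply: cell_point_inj; rewrite /cell_point /= sh'; congr pair.
  by apply: val_inj; rewrite /= sh'.
move=> uv; apply: rst_trans uv _; apply: glue_equiv_step; apply: Or33; split=> //=.
exists e; split; first by rewrite nth_set_nth /= eqxx.
  by have [_ /= /(_ e)] := set_mem uxy; rewrite he.
apply: (@eq_from_nth _ ht_1) => [|i _]; first by rewrite size_set_nth sh' (maxn_idPr eh).
rewrite nth_set_nth /=; case: eqP => [->//|/eqP ie].
by rewrite nth_set_nth /= (negbTE ie).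
Qed.

Lemma homotopy0 q : homotopy q 0 = q.
Proof. by rewrite -[q in LHS]reprK homotopyE -[RHS]reprK; apply/realizationP/shrink0. Qed.

(** A bipartite tree has no black edge, so there is no height to scale. *)
Lemma homotopy_incl (q : K1 R n) s : homotopy (K1_incl q) s = K1_incl q.
Proof.
rewrite -[q]reprK !K1_inclE homotopyE; apply/realizationP/eq_cell_point.
by rewrite /cell_point /=; congr pair; apply: val_inj.
Qed.

(** * The homotopy at time 1 *)

Lemma equiv_incl_retract (u v : cell_sumht) : equivht u v ->
  equivht v (cell_incl (retract v)) -> equivht u (cell_incl (retract u)).
Proof.
move=> uv vr; apply: rst_trans (uv) _; apply: rst_trans vr _.
by apply/rst_sym/cell_incl_glue/retract_equiv.
Qed.

Lemma T_ht_contract_subproof th : (0 < size (black_edges (val th).1))%N ->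
  [&& stably_bipartite (contract 0 (val th).1), well_labelled (contract 0 (val th).1)
    & size (behead (val th).2) == size (black_edges (contract 0 (val th).1))].
Proof.
move=> t0; have tt' := contraction_contract t0.
have /and3P[st wt /eqP sh] := valP th.
rewrite (stably_bipartite_contraction tt' st) (well_labelled_contraction tt') wt /=.
by rewrite size_behead sh (contraction_size_black_edges tt').
Qed.

(** The coordinates [(size h <= e)%:R] are 0 on the black edges and 1 outside, as [cube] demands.
    Such a point is glued along edge 0 to a point of the same kind on the tree with that edge
    contracted. *)
Lemma equiv_retract_bottom t : stably_bipartite t -> forall v : cell_sumht,
  (val (projT1 v)).1 = t ->
  (val (projT1 v)).2 = nseq (size (val (projT1 v)).2) ht_v ->
  (val (projT2 v)).2 = (fun e => (size (val (projT1 v)).2 <= e)%:R) ->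
  equivht v (cell_incl (retract v)).
Proof.
elim/stably_bipartite_ind => {}t st t0 => [|IH] [[[t' h] th] [[x y] xy]] /= tt' hv yh.
  (* Without black edges full contraction is the identity and all height coordinates are 1, so the
     point equals the inclusion of its retraction. *)
  have h0 : h = [::] by have /and3P[_ _ /= +] := th; rewrite tt' t0 => /nilP.
  apply: eq_cell_point; rewrite /cell_point /=; congr pair.
    by apply: val_inj; rewrite /= h0 tt' contract_all_id.
  by congr pair; rewrite yh; apply/funext => e; rewrite h0.
move: t' tt' th xy => _ -> th xy.
have tt' := contraction_contract t0.
have sh : size h = size (black_edges t) by have /and3P[_ _ /eqP] := th.
have h0 : (0 < size h)%N by rewrite sh.
pose th' : T_ht n := exist _ (contract 0 t, behead h)
    (@T_ht_contract_subproof (exist _ (t, h) th) t0).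
have xy' : (x, drop_coord 0 y) \in cell_ht th'.
  apply/mem_set; have [/= xt _] := set_mem xy; split=> /= [i|].
    by rewrite (arity_contraction _ tt').
  rewrite hv /= -[behead _]drop1 drop_nseq.
  apply: cube_nseq => e ek; rewrite yh /drop_coord /bump /=.
    by case: leqP; rewrite lexx ler01.
  by rewrite -leq_subLR ek.
apply: (@equiv_incl_retract _ (cell_at xy')).
  apply: glue_equiv_step; apply: Or32; split=> //=; exists 0%N; split=> //.
  - by rewrite hv nth_nseq h0.
  - by rewrite yh leqNgt h0.
  - by rewrite take0 drop1.
apply: IH => //=.
- by rewrite size_behead {1}hv -[behead _]drop1 drop_nseq subn1.
- rewrite yh; apply/funext => e; rewrite /drop_coord /bump /= size_behead.
  by case: (size h) h0.
Qed.

Lemma shrink1_retract (u : cell_sumht) :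
  equivht (shrink u 1) (cell_incl (retract (shrink u 1))).
Proof.
case: u => [[[t h] th] a]; have /and3P[st _ _] := th.
apply: (equiv_retract_bottom st) => //=; rewrite size_nseq//.
apply/funext => e; rewrite /scale_heights clamp_id ?lexx ?ler01// subrr mul0r.
by case: leqP.
Qed.

Lemma homotopy1 q : range (@K1_incl R n) (homotopy q 1).
Proof.
exists (\pi_(K1 R n) (retract (shrink (repr q) 1))) => //.
by rewrite K1_inclE; apply/realizationP/rst_sym/shrink1_retract.
Qed.

End Retraction.

Theorem proposition3 (R : realType) (n : nat) :
  topological_embedding (@K1_incl R n) /\
  strong_deformation_retract R (range (@K1_incl R n)).
Proof.
split; first exact: K1_incl_embedding.
exists (uncurry (@homotopy R n)); split=> /=.
- exact/continuous_subspaceT/homotopy_continuous.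
- exact: homotopy0.
- exact: homotopy1.
- by move=> _ s [q _ <-] _; exact: homotopy_incl.
Qed.
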